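(* Let $F_\Lambda=\{P_\lambda:\lambda\in\Lambda\}\subset\mathcal P(\Omega)$, $\Lambda\subseteq\mathbb R^d$, be a reference family such that every $P_\lambda\in F_\Lambda$ satisfies Assumptions 1 and 2 (stated in the context). For $\hat y\in\mathbb R^d$, let $P_{\hat\lambda}\in F_\Lambda$ be such that $\hat y=\mathbb E_{P_{\hat\lambda}}$, and let $S^*\subseteq\mathbb R^d$ be closed with $S^*\cap\operatorname{dom}\psi^*_{P_{\hat\lambda}}\neq\emptyset$. Then the MEM estimator $y_{MEM}$, i.e. a minimizer of $\psi^*_{P_{\hat\lambda}}$ over $S^*$, exists. If, in addition, $S^*$ is convex and $\operatorname{int}(\operatorname{dom}\psi^*_{P_{\hat\lambda}})\cap S^*\neq\emptyset$, then $y_{MEM}$ is unique and lies in $\operatorname{int}(\operatorname{dom}\psi^*_{P_{\hat\lambda}})\cap S^*$.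
   Context: Setting: $(\Omega,\Sigma)$ is a measurable space with $\Omega\subseteq\mathbb R^d$ and dominating measure $\nu$; either $\Omega=\mathbb R^d$ and $\nu$ is Lebesgue measure, or $\Omega$ is a countable subset of $\mathbb R^d$ and $\nu$ is the counting measure. $\mathcal P(\Omega)$ is the set of probability measures on $\Omega$ that are absolutely continuous with respect to $\nu$. For a measure $P$, the support $\Omega_P$ is the minimal closed measurable set $A\in\Sigma$ with $P(\Omega\setminus A)=0$, and $\Omega_P^{cc}:=\operatorname{cl}(\operatorname{conv}\Omega_P)$. $\mathbb E_Q:=\int_\Omega y\,dQ(y)$. $\Theta_P:=\{\theta\in\mathbb R^d:\int_\Omega e^{\langle y,\theta\rangle}dP(y)<\infty\}$; $\psi_P(\theta)=\log\int_\Omega e^{\langle y,\theta\rangle}dP(y)$ for $\theta\in\Theta_P$ and $+\infty$ otherwise; the Cramér rate function is the conjugate $\psi_P^*(y):=\sup\{\langle y,\theta\rangle-\psi_P(\theta):\theta\in\mathbb R^d\}$. The exponential family generated by $P$ is minimal if $\operatorname{int}\Theta_P\ne\emptyset$ and $\operatorname{int}\Omega_P^{cc}\neq\emptyset$; it is steep if $\psi_P$ is essentially smooth, i.e. $\operatorname{int}(\operatorname{dom}\psi_P)\ne\emptyset$, $\psi_P$ is differentiable there, and $\|\nabla\psi_P(x^k)\|\to\infty$ for every sequence in $\operatorname{int}(\operatorname{dom}\psi_P)$ converging to a boundary point of $\operatorname{dom}\psi_P$. Assumption 1 on $P$: $P$ generates a minimal and steep exponential family and $0\in\operatorname{int}\Theta_P$.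 Assumption 2 on $P$: either $\Omega_P$ is uncountable, or $\Omega_P$ is countable and $\operatorname{conv}\Omega_P$ is closed. A reference family is a parameterized family $F_\Lambda=\{P_\lambda:\lambda\in\Lambda\subseteq\mathbb R^d\}\subset\mathcal P(\Omega)$ such that $\mathbb E_{P_{\lambda_1}}=\mathbb E_{P_{\lambda_2}}$ if and only if $\lambda_1=\lambda_2$. For an observation $\hat y$ with $\hat y=\mathbb E_{P_{\hat\lambda}}$, $P_{\hat\lambda}\in F_\Lambda$, and a nonempty closed set $S^*\subseteq\mathbb R^d$, the MEM estimator is $y_{MEM}:=\operatorname{argmin}\{\psi^*_{P_{\hat\lambda}}(y):y\in S^*\}$. *)

(* Defs.v *)
From HB Require Import structures.
From mathcomp Require Import all_boot all_order all_algebra.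
From mathcomp Require Import all_classical all_reals all_analysis.

Set Implicit Arguments.
Unset Strict Implicit.
Unset Printing Implicit Defensive.

Import Order.TTheory GRing.Theory Num.Theory.
Import numFieldNormedType.Exports.

Local Open Scope classical_set_scope.
Local Open Scope ring_scope.

(* The Borel sigma-algebra on matrices, in particular on R^d = 'rV[R]_d. *)
HB.instance Definition _ (R : realType) (m n : nat) :=
  @isMeasurable.Build (sigma_display (@open 'M[R]_(m, n))) 'M[R]_(m, n)
    <<s @open 'M[R]_(m, n) >>
    (@sigma_algebra0 _ setT _) (@sigma_algebraC _ _)
    (@sigma_algebra_bigcup _ setT _).

Section vectors.
Context {R : realType} {d : nat}.
Implicit Types x y : 'rV[R]_d.

Definition dot x y : R := \sum_(i < d) x ord0 i * y ord0 i.

(* The library norm on 'rV[R]_d is the sup norm. *)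
Definition enorm x : R := Num.sqrt (dot x x).

Definition gradient (f : 'rV[R]_d -> R) x : 'rV[R]_d :=
  \row_(i < d) 'D_(delta_mx ord0 i) (f : 'rV[R]_d -> R^o) x.

Definition conv (A : set 'rV[R]_d) : set 'rV[R]_d :=
  smallest (@convex_set R 'rV[R]_d) A.

(* Lebesgue measure is the unique Borel measure giving every box its volume. *)
Definition is_lebesgue (nu : {measure set 'rV[R]_d -> \bar R}) : Prop :=
  forall a b : 'rV[R]_d, (forall i, a ord0 i <= b ord0 i) ->
    nu [set x | forall i, a ord0 i < x ord0 i <= b ord0 i] =
    (\prod_(i < d) (b ord0 i - a ord0 i))%:E.

(* Measures on Omega are represented by Borel measures on R^d vanishing
   outside Omega. Both kinds of Omega are Borel sets. *)
Definition dominating (Omega : set 'rV[R]_d)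
    (nu : {measure set 'rV[R]_d -> \bar R}) : Prop :=
  (Omega = setT /\ is_lebesgue nu) \/
  (countable Omega /\
   forall A, measurable A -> nu A = counting (A `&` Omega)).

End vectors.

Section convex_functions.
Context {R : realType} {d : nat}.
Implicit Types f : 'rV[R]_d -> \bar R.

Definition edom f : set 'rV[R]_d := [set x | (f x < +oo)%E].

Definition conjugate f (y : 'rV[R]_d) : \bar R :=
  ereal_sup (range (fun theta => ((dot y theta)%:E - f theta)%E)).

(* [f] is meant not to take the value -oo, so that [fine] is harmless on
   [edom f]. *)
Definition essentially_smooth f : Prop :=
  [/\ (edom f)° !=set0,
      forall x, (edom f)° x -> differentiable (fine \o f : _ -> R^o) x &
      forall (u : nat -> 'rV[R]_d) (x : 'rV[R]_d),
        (forall k, (edom f)° (u k)) ->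
        u @ \oo --> x ->
        (closure (edom f) `\` (edom f)°) x ->
        enorm (gradient (fine \o f) (u k)) @[k --> \oo] --> +oo].

Definition argmin f (S : set 'rV[R]_d) : set 'rV[R]_d :=
  [set y | S y /\ forall z, S z -> (f y <= f z)%E].

End convex_functions.

Section exponential_families.
Context {R : realType} {d : nat}.
Variable Omega : set 'rV[R]_d.
Implicit Type P : probability 'rV[R]_d R.

(* The intersection of all candidates is itself one, R^d being second
   countable. Closedness is relative to Omega, as the support belongs to the
   sigma-algebra of subsets of Omega. *)
Definition msupport P : set 'rV[R]_d :=
  \bigcap_(A in [set A | [/\ measurable A,
                             exists2 F, closed F & A = Omega `&` F &
                             P (Omega `\` A) = 0%E]]) A.

Definition msupport_cc P : set 'rV[R]_d := closure (conv (msupport P)).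

(* Junk value in the coordinates that are not integrable; there are none when
   0 is interior to the domain of the log-Laplace transform. *)
Definition mean P : 'rV[R]_d :=
  \row_(i < d) Rintegral P Omega (fun y : 'rV[R]_d => y ord0 i).

Definition laplace P (theta : 'rV[R]_d) : \bar R :=
  (\int[P]_(y in Omega) (expR (dot y theta))%:E)%E.

Definition Theta P : set 'rV[R]_d := [set theta | (laplace P theta < +oo)%E].

Definition psi P (theta : 'rV[R]_d) : \bar R :=
  if `[< Theta P theta >] then (ln (fine (laplace P theta)))%:E else +oo%E.

Definition cramer P : 'rV[R]_d -> \bar R := conjugate (psi P).

Definition minimal_family P : Prop :=
  (Theta P)° !=set0 /\ (msupport_cc P)° !=set0.

Definition steep_family P : Prop := essentially_smooth (psi P).

Definition assumption1 P : Prop :=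
  [/\ minimal_family P, steep_family P & (Theta P)° 0].

Definition assumption2 P : Prop :=
  ~ countable (msupport P) \/
  (countable (msupport P) /\ closed (conv (msupport P))).

(* Only the values of [F] on [Lambda] matter. *)
Definition reference_family (nu : {measure set 'rV[R]_d -> \bar R})
    (Lambda : set 'rV[R]_d) (F : 'rV[R]_d -> probability 'rV[R]_d R) : Prop :=
  (forall l, Lambda l -> F l `<< nu) /\
  (forall l1 l2, Lambda l1 -> Lambda l2 -> (mean (F l1) = mean (F l2) <-> l1 = l2)).

Definition mem_estimators P (S : set 'rV[R]_d) : set 'rV[R]_d :=
  argmin (cramer P) S.

End exponential_families.

(* Main.v *)
Require Import Defs.
From mathcomp Require Import all_boot all_order all_algebra.
From mathcomp Require Import all_classical all_reals all_analysis.
From mathcomp Require Import measurable_realfun ring lra.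

(** Write f for the log-Laplace transform and g for its conjugate. Since 0 is
    interior to dom f, the lower semicontinuous function g is coercive, which
    gives existence. Let y0 minimize g over a convex S that meets int (dom g) at
    y1. On the segment from y1 towards y0 the points have g-subgradients, and
    these stay bounded because g increases away from y0. A limit point x is a
    minimizer of f - <y0, .>, unique by strict convexity of f (no hyperplane
    carries P), so f - <y0, .> grows linearly away from x and y0 is interior to
    dom g. Finally, a subgradient at the midpoint of two minimizers is one at
    both, so both belong to the subdifferential of f at one point; steepness
    forces that point into int (dom f), where f is differentiable. *)

Import Order.TTheory GRing.Theory Num.Theory.
Import numFieldNormedType.Exports.

Local Open Scope classical_set_scope.
Local Open Scope ring_scope.

(** * Inner product and sup norm on R^d *)

Lemma near_dist_lt {R : realType} {d : nat} (x : 'rV[R]_d) (e : R) : 0 < e ->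
  \forall z \near x, `|x - z| < e.
Proof.
move=> e0; have h : id @ x --> x by exact: cvg_id.
exact: cvgr_dist_lt h _ e0.
Qed.

Section dot.
Context {R : realType} {d : nat}.
Implicit Types x y z : 'rV[R]_d.

Lemma dotC x y : dot x y = dot y x.
Proof. by apply: eq_bigr => i _; rewrite mulrC. Qed.

Lemma dotDr x y z : dot x (y + z) = dot x y + dot x z.
Proof. by rewrite -big_split; apply: eq_bigr => i _; rewrite mxE mulrDr. Qed.

Lemma dotZr x (a : R) y : dot x (a *: y) = a * dot x y.
Proof. by rewrite mulr_sumr; apply: eq_bigr => i _; rewrite mxE mulrCA. Qed.

Lemma dotNr x y : dot x (- y) = - dot x y.
Proof. by rewrite -scaleN1r dotZr mulN1r. Qed.

Lemma dotDl x y z : dot (y + z) x = dot y x + dot z x.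
Proof. by rewrite dotC dotDr !(dotC x). Qed.

Lemma dotZl x (a : R) y : dot (a *: y) x = a * dot y x.
Proof. by rewrite dotC dotZr dotC. Qed.

Lemma dotNl x y : dot (- y) x = - dot y x.
Proof. by rewrite dotC dotNr dotC. Qed.

Lemma dot0r x : dot x 0 = 0.
Proof. by rewrite -(scale0r 0) dotZr mul0r. Qed.

Lemma dot_delta x i : dot x (delta_mx ord0 i) = x ord0 i.
Proof.
rewrite /dot (bigD1 i)//= big1 ?addr0; first by rewrite mxE !eqxx mulr1.
by move=> j ji; rewrite mxE eqxx (negbTE ji) mulr0.
Qed.

Lemma dot_self_eq0 x : dot x x = 0 -> x = 0.
Proof.
move=> /psumr_eq0P xx0; apply/rowP => i; rewrite mxE.
by apply/eqP; rewrite -sqrf_eq0 expr2 xx0// => j _; rewrite -expr2 sqr_ge0.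
Qed.

Definition dotE := (dotDl, dotDr, dotNl, dotNr, dotZl, dotZr, @dot0r).

Lemma coord_le_norm x i : `|x ord0 i| <= `|x|.
Proof.
rewrite [leRHS]/Num.Def.normr/= mx_normrE.
exact: (le_bigmax _ (fun j : 'I_1 * 'I_d => `|x j.1 j.2|) (ord0, i)).
Qed.

Lemma norm_le_coord x (c : R) :
  0 <= c -> (forall i, `|x ord0 i| <= c) -> `|x| <= c.
Proof.
move=> c0 xc; rewrite [leLHS]/Num.Def.normr/= mx_normrE.
apply/bigmax_leP; split => //; by case=> i j _ /=; rewrite (ord1 i).
Qed.

(** Both norms are sup norms, so the bound sums [d] equal terms; hence the factor. *)
Lemma dot_le_norm x y : `|dot x y| <= d%:R * `|x| * `|y|.
Proof.
apply: (le_trans (ler_norm_sum _ _ _)).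
apply: (@le_trans _ _ (\sum_(i < d) `|x| * `|y|)).
  by apply: ler_sum => i _; rewrite normrM ler_pM ?coord_le_norm.
by rewrite sumr_const card_ord -mulrA mulr_natl.
Qed.

Lemma enorm_le_norm x : enorm x <= Num.sqrt d%:R * `|x|.
Proof.
rewrite -(ger0_norm (normr_ge0 x)) -sqrtr_sqr -sqrtrM// ler_wsqrtr//.
by rewrite (le_trans (ler_norm _))// (le_trans (dot_le_norm _ _))// expr2 mulrA.
Qed.

Lemma continuous_dot x : continuous (dot x).
Proof.
move=> y; apply/(@cvgrPdist_le _ _ _ (nbhs y)) => e e0.
have K0 : 0 < d%:R * `|x| + 1 by rewrite ltr_wpDl// mulr_ge0.
apply: filterS (near_dist_lt y _ (divr_gt0 e0 K0)).
move=> z /ltW yz.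
rewrite -dotNr -dotDr (le_trans (dot_le_norm _ _))//.
apply: (@le_trans _ _ ((d%:R * `|x| + 1) * `|y - z|)).
  by rewrite ler_wpM2r// lerDl.
by rewrite mulrC -ler_pdivlMr.
Qed.

(* The sup norm is the support function of the cross-polytope, whose vertices
   are the [s *: delta_mx ord0 i]. *)
Lemma norm_le_support x (r M : R) : 0 < r -> 0 <= M ->
  (forall i s, `|s| = r -> s * x ord0 i <= M) -> r * `|x| <= M.
Proof.
move=> r0 M0 h; rewrite mulrC -ler_pdivlMr//; apply: norm_le_coord => [|i].
  by rewrite divr_ge0// ltW.
rewrite ler_pdivlMr// mulrC.
have [xi|xi] := ler0P (x ord0 i).
  by rewrite mulrN -mulNr h// normrN gtr0_norm.
by rewrite h// gtr0_norm.
Qed.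

End dot.

(** * Minimization of lower semicontinuous functions *)

Section lower_semicontinuity.
Context {R : realType}.
Local Open Scope ereal_scope.

Lemma lscD_continuous (X : topologicalType) (f : X -> \bar R) (h : X -> R) :
  lower_semicontinuous f -> continuous h ->
  lower_semicontinuous (fun x => f x + (h x)%:E).
Proof.
move=> lf ch x a afx.
(* The slack is shared out: [f] stays above [b] near [x], and [h] has to lose less than
   [b - (a - h x)]. *)
have [b [bf ab]] : exists b : R, b%:E < f x /\ (a - h x < b)%R.
  case: (f x) afx => [c||].
  - rewrite -EFinD !lte_fin => ac; exists ((a - h x + c) / 2)%R.
    by rewrite lte_fin; split; lra.
  - by move=> _; exists (a - h x + 1)%R; rewrite ltry; split => //; lra.
  - by rewrite ltNge leNye.
have [V xV Vb] := lf x b bf.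
have hV : \forall z \near x, (`|h x - h z| < b - (a - h x))%R.
  by apply: cvgr_dist_lt; [exact: ch|rewrite subr_gt0].
exists (V `&` [set z | (`|h x - h z| < b - (a - h x))%R]).
  exact: filterI.
move=> z [/Vb bz] /=; rewrite ltr_norml => /andP[_ hz].
apply: (@lt_trans _ _ (b%:E + (h z)%:E)); last by rewrite lteD2rE.
by rewrite -EFinD lte_fin; lra.
Qed.

Lemma lte_between (x y : \bar R) : x < y -> exists2 c : R, x < c%:E & c%:E < y.
Proof.
case: x y => [x||] [y||]//.
- by rewrite lte_fin => xy; exists ((x + y) / 2)%R; rewrite lte_fin; lra.
- by move=> _; exists (x + 1)%R; rewrite ?ltry// lte_fin; lra.
- by move=> _; exists (y - 1)%R; rewrite ?ltNyr// lte_fin; lra.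
- by move=> _; exists 0%R; rewrite ?ltry ?ltNyr.
Qed.

(** The sublevel sets above the infimum generate a proper filter on [K]. By lower semicontinuity,
    [f] at a cluster point cannot exceed the infimum. *)
Lemma lsc_compact_argmin (X : topologicalType) (f : X -> \bar R) (K : set X) :
  lower_semicontinuous f -> compact K -> K !=set0 ->
  exists2 x, K x & forall z, K z -> f x <= f z.
Proof.
move=> lf cK [x0 Kx0].
set m := ereal_inf (f @` K).
have mlb z : K z -> m <= f z by move=> Kz; apply: ereal_inf_lbound; exists z.
(* If the infimum is [+oo], no level lies above it and the filter has no base. *)
have [moo|moo] := eqVneq m +oo.
  exists x0 => // z /mlb; rewrite moo leye_eq => /eqP ->; exact: leey.
pose F := filter_from [set c | m < c] (fun c => K `&` [set z | f z < c]).
have FF : ProperFilter F.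
  apply: filter_from_proper; last first.
    move=> c /= mc; have [_ [z Kz <-] fz] := ereal_inf_lt mc.
    by exists z.
  apply: filter_from_filter.
    by exists +oo; rewrite /= ltey.
  move=> c1 c2 m1 m2; exists (mine c1 c2); first by rewrite /= lt_min m1 m2.
  by move=> z [Kz] /=; rewrite lt_min => /andP[].
have FK : F K by exists +oo; [rewrite /= ltey|move=> z []].
have [x [Kx clx]] := cK F FF FK.
exists x => // z Kz; apply: le_trans (mlb z Kz); rewrite leNgt; apply/negP => mx.
have [c mc cx] := lte_between _ _ mx.
have [V xV Vc] := lf x c cx.
have FA : F (K `&` [set z | f z < c%:E]) by exists c%:E.
have [w [[_ /= wc] /Vc cw]] := clx _ _ FA xV.
by move: (lt_trans wc cw); rewrite ltxx.
Qed.

(** Outside a large ball [f] exceeds its value at a chosen point of [S], so it suffices to minimize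
    over a compact piece of [S]. *)
Lemma lsc_coercive_argmin d (f : 'rV[R]_d -> \bar R) (S : set 'rV[R]_d)
    (r M : R) :
  lower_semicontinuous f -> closed S -> (0 < r)%R ->
  (forall x, (r * `|x| - M)%:E <= f x) -> S !=set0 -> argmin f S !=set0.
Proof.
move=> lf cS r0 coer [s0 Ss0].
have [[s Ss fs]|h] := pselect (exists2 s, S s & f s < +oo); last first.
  exists s0; split => // z Sz; suff -> : f z = +oo by exact: leey.
  by apply/eqP; rewrite eq_le leey leNgt; apply/negP => fz; apply: h; exists z.
have [c fc] : exists c : R, f s = c%:E.
  by move: (coer s) fs; case: (f s) => // c _ _; exists c.
pose K := S `&` [set x | `|x| <= (c + M) / r]%R.
have sK : K s.
  by split => //=; rewrite ler_pdivlMr// mulrC -lerBlDr -lee_fin -fc coer.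
have cK : compact K.
  apply: bounded_closed_compact.
    exists ((c + M) / r)%R; split; first exact: num_real.
    by move=> N /ltW cN x [_ /= xc]; exact: le_trans cN.
  apply: closedI => //.
  have -> : [set x : 'rV[R]_d | `|x| <= (c + M) / r]%R =
      (fun x => `|x|%R) @^-1` [set t | t <= (c + M) / r]%R by [].
  by apply: closed_comp; [move=> ? _; exact: norm_continuous|exact: closed_le].
have [x [Sx _] xm] := lsc_compact_argmin _ _ _ lf cK (ex_intro _ s sK).
exists x; split => // z Sz.
have [zK|zK] := leP (`|z|)%R ((c + M) / r)%R; first exact: xm.
apply: (le_trans (xm s sK)); rewrite fc; apply: le_trans (coer z).
by rewrite lee_fin lerBrDr mulrC -ler_pdivrMr// ltW.
Qed.

End lower_semicontinuity.

(** * Convex functions and conjugates *)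

Section convex_efun.
Context {R : realType} {d : nat}.
Implicit Types f g : 'rV[R]_d -> \bar R.

(** Real upper bounds replace the values of [f], so that no sum of infinities arises and points with
    value [+oo] impose nothing. *)
Definition convex_efun f := forall x y (a b t : R), 0 <= t <= 1 ->
  (f x <= a%:E)%E -> (f y <= b%:E)%E ->
  (f ((1 - t) *: x + t *: y)%R <= ((1 - t) * a + t * b)%:E)%E.

Definition subgradient f (x p : 'rV[R]_d) := exists2 a : R,
  f x = a%:E & forall z, ((a + dot p (z - x))%:E <= f z)%E.

Lemma near_ball_sub (A : set 'rV[R]_d) x : A° x ->
  exists2 e : R, 0 < e & forall z, `|z - x| < e -> A z.
Proof.
move=> /nbhs_ballP[e /= e0 xA]; exists e => // z zx; apply: xA.
by rewrite mx_norm_ball /ball_ /= distrC.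
Qed.

Lemma interior_ball (A : set 'rV[R]_d) x (e : R) : 0 < e ->
  (forall z, `|z - x| < e -> A z) -> A° x.
Proof.
move=> e0 xA; apply/nbhs_ballP; exists e => // z.
by rewrite mx_norm_ball /ball_ /= distrC; exact: xA.
Qed.

(** The homothety of centre [x] and ratio [t] sends the [e]-ball around [y] to a [t * e]-ball inside
    [A]. *)
Lemma convex_interior (A : set 'rV[R]_d) x y (t : R) : 0 < t <= 1 ->
  (forall z w, A z -> A w -> A ((1 - t) *: z + t *: w)) ->
  A x -> A° y -> A° ((1 - t) *: x + t *: y).
Proof.
move=> /andP[t0 t1] cA Ax /near_ball_sub[e e0 yA].
apply: (@interior_ball _ _ (t * e)); first exact: mulr_gt0.
move=> z zu.
have -> : z = (1 - t) *: x + t *: (t^-1 *: (z - (1 - t) *: x)).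
  by rewrite scalerA divff ?gt_eqF// scale1r addrC subrK.
apply: cA => //; apply: yA.
have -> : t^-1 *: (z - (1 - t) *: x) - y =
    t^-1 *: (z - ((1 - t) *: x + t *: y)).
  apply/rowP => i; rewrite !mxE; field; exact: lt0r_neq0.
by rewrite normrZ gtr0_norm ?invr_gt0// mulrC ltr_pdivrMr// mulrC.
Qed.

Lemma convex_edom f : convex_efun f -> (forall x, -oo < f x)%E ->
  forall x y (t : R), 0 <= t <= 1 -> edom f x -> edom f y ->
  edom f ((1 - t) *: x + t *: y).
Proof.
move=> cf fNy x y t t01; rewrite /edom/=.
case: (f x) (fNy x) (cf x y) => // a _ + _; case: (f y) (fNy y) => // b _ h _.
by rewrite (le_lt_trans (h a b t _ _ _))// ltry.
Qed.

(** Only finitely many points are involved: [x] and the vertices of a small cross-polytope around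
    it. This is the form in which [norm_le_support] uses interiority. *)
Lemma interior_edom_bound f x : (edom f)° x -> exists r M : R,
  [/\ 0 < r, 0 <= M, (f x <= M%:E)%E &
  forall i s, `|s| = r -> (f (x + s *: delta_mx ord0 i)%R <= M%:E)%E].
Proof.
move=> /near_ball_sub[e e0 xf].
have fin_bound z : edom f z -> (f z <= `|fine (f z)|%:E)%E.
  by rewrite /edom/=; case: (f z) => [a||]; rewrite ?leNye// lee_fin ler_norm.
pose F (i : 'I_d) (s : R) := `|fine (f (x + s *: delta_mx ord0 i))|.
have F0 i s : 0 <= F i s by exact: normr_ge0.
(* A sum of absolute values serves as a common bound for all these points. *)
exists (e / 2), (`|fine (f x)| + \sum_i (F i (e / 2) + F i (- (e / 2)))).
have sum0 : 0 <= \sum_i (F i (e / 2) + F i (- (e / 2))).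
  by apply: sumr_ge0 => i _; rewrite addr_ge0.
split; [by rewrite divr_gt0|by rewrite addr_ge0| |].
- apply: (le_trans (fin_bound x _)); last by rewrite lee_fin lerDl.
  by apply: xf; rewrite subrr normr0.
- move=> i s sr; apply: (le_trans (fin_bound _ _)).
    apply: xf; rewrite addrAC subrr add0r normrZ sr.
    rewrite (@le_lt_trans _ _ (e / 2))//; last by lra.
    rewrite ler_piMr ?(ltW (divr_gt0 e0 _))//.
    apply: norm_le_coord => // j; rewrite mxE eqxx /=.
    by case: (j == i); rewrite ?normr1 ?normr0.
  rewrite lee_fin -/(F i s) (bigD1 i)//=.
  have sum1 : 0 <= \sum_(j | j != i) (F j (e / 2) + F j (- (e / 2))).
    by apply: sumr_ge0 => j _; rewrite addr_ge0.
  have := normr_ge0 (fine (f x)).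
  have := F0 i (e / 2); have := F0 i (- (e / 2)).
  suff [->|->] : s = e / 2 \/ s = - (e / 2) by lra.
  have [s0|s0] := ler0P s; [right|left].
    by move: sr; rewrite ler0_norm// => <-; rewrite opprK.
  by move: sr; rewrite gtr0_norm.
Qed.

Lemma le_conjugateP f y (b : R) : (forall x, -oo < f x)%E ->
  (conjugate f y <= b%:E)%E <->
  (forall x (a : R), (f x <= a%:E)%E -> dot y x - a <= b).
Proof.
move=> fNy; split.
  move=> /ereal_supP h x a fa.
  have := h _ (ex_intro2 _ _ x I erefl).
  case: (f x) (fNy x) fa => // c _; rewrite lee_fin => ca.
  by rewrite -EFinB lee_fin; apply: le_trans; rewrite lerD2l lerN2.
move=> h; apply/ereal_supP => _ [x _ <-].
have := h x; case: (f x) (fNy x) => [c||]// _; last by rewrite leNye.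
by move=> /(_ c); rewrite lexx -EFinB lee_fin => /(_ isT).
Qed.

Lemma young f x y (a : R) : f x = a%:E -> ((dot y x - a)%:E <= conjugate f y)%E.
Proof. by move=> fx; apply: ereal_sup_ubound; exists x => //; rewrite fx. Qed.

Lemma conjugate_gtNy f y : (forall x, -oo < f x)%E -> edom f !=set0 ->
  (-oo < conjugate f y)%E.
Proof.
move=> fNy [x]; rewrite /edom/=; case fx : (f x) (fNy x) => [a||]// _ _.
by apply: lt_le_trans (young _ _ y _ fx); rewrite ltNyr.
Qed.

Lemma conjugate_convex f : (forall x, -oo < f x)%E -> convex_efun (conjugate f).
Proof.
move=> fNy x y a b t /andP[t0 t1] /le_conjugateP xa /le_conjugateP yb.
apply/le_conjugateP => // z c fc.
have := xa fNy z c fc; have := yb fNy z c fc; rewrite !dotE; nra.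
Qed.

Lemma conjugate_lsc f : (forall x, -oo < f x)%E ->
  lower_semicontinuous (conjugate f).
Proof.
move=> fNy y a /ereal_sup_gtP[_ [x _ <-]].
case fx : (f x) (fNy x) => [c||]// _; rewrite -EFinB lte_fin => ac.
exists [set z | a + c < dot x z].
  have cx : dot x z @[z --> y] --> dot x y by exact: continuous_dot.
  by apply: (cvgr_gt _ cx); rewrite dotC; lra.
move=> z /= acz; apply: lt_le_trans (young _ _ z _ fx).
by rewrite lte_fin dotC; lra.
Qed.

(** Finiteness of the conjugate around [u] makes [f - dot u] coercive, and [u] is a subgradient of
    [f] at any minimizer of that function. *)
Lemma conjugate_subgradient_exists f u : (forall x, -oo < f x)%E ->
  lower_semicontinuous f -> edom f !=set0 -> (edom (conjugate f))° u ->
  exists x, subgradient f x u.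
Proof.
move=> fNy lf [x0 fx0] /interior_edom_bound[r [M [r0 M0 /le_conjugateP uM urM]]].
pose h x := (f x + (- dot u x)%:E)%E.
have lh : lower_semicontinuous h.
  apply: lscD_continuous => // x.
  exact: (@cvgN _ _ _ (nbhs x) _ _ _ (continuous_dot _ x)).
have coer x : ((r * `|x| - M)%:E <= h x)%E.
  rewrite /h; case fx : (f x) (fNy x) => [c||]// _; last by rewrite addye ?leey.
  rewrite -EFinD lee_fin.
  have le1 : dot u x - c <= M by apply: uM => //; rewrite fx.
  suff : r * `|x| <= M + c - dot u x by lra.
  apply: norm_le_support => //; first lra.
  move=> i s sr; have := iffLR (le_conjugateP _ _ _ fNy) (urM i s sr) x c.
  rewrite fx lexx => /(_ isT).
  by rewrite !dotE (dotC (delta_mx _ _)) dot_delta; lra.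
have [x [_ xm]] := lsc_coercive_argmin _ _ setT _ _ lh closedT r0 coer
  (ex_intro _ x0 I).
exists x; have := xm x0 I; move: fx0; rewrite /edom/= /h.
case: (f x0) (fNy x0) => // c0 _ _.
case fx : (f x) (fNy x) => [c||]// _ _; exists c => // z.
have := xm z I; rewrite /h fx; case: (f z) (fNy z) => [b _||]//.
  by rewrite -!EFinD !lee_fin !dotE; lra.
by move=> _ _; rewrite leey.
Qed.

(* The constant does not depend on [t]: subgradients stay bounded along the
   segment from [x1] down to [x0]. *)
Lemma subgradient_bound f x0 x1 p q (a0 a t r M : R)
    (u := (1 - t) *: x0 + t *: x1) :
  0 < t <= 1 -> 0 < r -> (f x1 <= M%:E)%E ->
  (forall i s, `|s| = r -> (f (x1 + s *: delta_mx ord0 i)%R <= M%:E)%E) ->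
  (f x0 <= a0%:E)%E -> (forall z, ((a + dot p (z - u))%:E <= f z)%E) ->
  a0 + dot q (u - x0) <= a -> r * `|p| <= M - a0 - dot q (x1 - x0).
Proof.
move=> /andP[t0 t1] r0 fx1 fx1s fx0 sub qa.
have := le_trans (sub x1) fx1; have := le_trans (sub x0) fx0.
rewrite !lee_fin.
have -> : x0 - u = - (t *: (x1 - x0)).
  by apply/rowP => i; rewrite !mxE; ring.
have x1u : x1 - u = (1 - t) *: (x1 - x0).
  by apply/rowP => i; rewrite !mxE; ring.
rewrite x1u !(dotNr, dotZr) => A B.
have {}qa : a0 + t * dot q (x1 - x0) <= a.
  move: qa; congr (_ <= _); rewrite -dotZr; congr (_ + dot _ _).
  by apply/rowP => i; rewrite !mxE; ring.
(* The slope of [p] along the segment dominates that of [q]: compare the subgradient inequality at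
   [x0] with [qa] and divide by [t]. *)
have kl : dot q (x1 - x0) <= dot p (x1 - x0).
  by rewrite -(ler_pM2l t0); lra.
have kl1 : (1 - t) * dot q (x1 - x0) <= (1 - t) * dot p (x1 - x0).
  by rewrite ler_wpM2l// subr_ge0.
(* The inequality at [x1 + s *: delta_mx ord0 i] bounds [s * p_i]; by [qa] and [kl1] the terms in
   [t] add up to one full [dot q (x1 - x0)]. *)
apply: norm_le_support => //; first lra.
move=> i s sr; have := le_trans (sub _) (fx1s i s sr).
by rewrite lee_fin addrAC x1u dotDr !(dotZr p) dot_delta; lra.
Qed.

Lemma le_of_le_addM (a b k : R) : (forall t, 0 < t <= 1 -> a <= b + t * k) ->
  a <= b.
Proof.
move=> h; rewrite leNgt; apply/negP => ba.
have := h 1; rewrite ltr01 lexx => /(_ isT) h1.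
have k0 : 0 < k by lra.
(* This [t] makes [t * k] half of the supposed gap [a - b]. *)
have t0 : 0 < (a - b) / (2 * k) by rewrite divr_gt0 ?mulr_gt0//; lra.
have t1 : (a - b) / (2 * k) <= 1 by rewrite ler_pdivrMr ?mulr_gt0//; lra.
have := h ((a - b) / (2 * k)); rewrite t0 t1 => /(_ isT).
have -> : (a - b) / (2 * k) * k = (a - b) / 2 by field; lra.
lra.
Qed.

(* Subgradients [x_t] for points [u_t -> y0] on the segment stay in a compact
   set; a minimizer of [f - dot y0] over that set is a global one. *)
Lemma segment_subgradient f y0 y1 : (forall x, -oo < f x)%E ->
  lower_semicontinuous f -> edom f !=set0 ->
  edom (conjugate f) y0 -> (edom (conjugate f))° y1 ->
  (forall t, 0 < t <= 1 ->
    (conjugate f y0 <= conjugate f ((1 - t) *: y0 + t *: y1)%R)%E) ->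
  exists x, subgradient f x y0.
Proof.
move=> fNy lf f0 gy0 gy1 gmin.
have [r [M [r0 M0 uM urM]]] := interior_edom_bound _ _ gy1.
have gNy y : (-oo < conjugate f y)%E by exact: conjugate_gtNy.
have [a0 ga0] : exists a : R, conjugate f y0 = a%:E.
  move: gy0 (gNy y0); rewrite /edom/=.
  by case: (conjugate f y0) => // a; exists a.
have cg := conjugate_convex f fNy.
pose u t := (1 - t) *: y0 + t *: y1.
pose C := (M - a0) / r.
have key t : 0 < t <= 1 -> exists x b, [/\ f x = b%:E, `|x| <= C &
    forall z, ((b + dot (u t) (z - x))%:E <= f z)%E].
  move=> t01.
  have ut : (edom (conjugate f))° (u t).
    apply: convex_interior => // z w; apply: convex_edom => //.
    by case/andP: t01 => t0 ->; rewrite ltW.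
  have [x [b fx sx]] := conjugate_subgradient_exists _ _ fNy lf f0 ut.
  (* Equality case of Young's inequality at a subgradient. *)
  have gu : (conjugate f (u t) <= (dot (u t) x - b)%:E)%E.
    apply/le_conjugateP => // z c fc; have := le_trans (sx z) fc.
    by rewrite lee_fin !dotE; lra.
  exists x, b; split => //.
  rewrite /C ler_pdivlMr// mulrC.
  have -> : M - a0 = M - a0 - dot 0 (y1 - y0) by rewrite dotC dot0r subr0.
  (* Here [x] is a subgradient of the conjugate at [u t], and the lower slope [q] is 0 because [y0]
     is minimal on the segment. *)
  apply: (@subgradient_bound (conjugate f) y0 y1 x 0 a0 (dot (u t) x - b) t r M);
    rewrite ?ga0//.
    move=> z; apply: le_trans (young _ _ z _ fx).
    by rewrite lee_fin !dotE !(dotC x); lra.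
  have := le_trans (gmin t t01) gu; rewrite ga0 lee_fin.
  by rewrite (dotC 0) dot0r addr0.
pose K := [set x : 'rV[R]_d | `|x| <= C].
have cK : compact K.
  apply: bounded_closed_compact.
    exists C; split; first exact: num_real.
    by move=> N /ltW cN x xc; exact: le_trans cN.
  have -> : K = (fun x => `|x|) @^-1` [set t | t <= C] by [].
  by apply: closed_comp; [move=> ? _; exact: norm_continuous|exact: closed_le].
have [x1 [b1 [fx1 x1C _]]] := key 1 ltac:(by rewrite ltr01 lexx).
pose h x := (f x + (- dot y0 x)%:E)%E.
have lh : lower_semicontinuous h.
  apply: lscD_continuous => // x.
  exact: (@cvgN _ _ _ (nbhs x) _ _ _ (continuous_dot _ x)).
have [x Kx xmin] := lsc_compact_argmin _ _ _ lh cK (ex_intro _ x1 x1C).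
have [c fx] : exists c : R, f x = c%:E.
  have := xmin x1 x1C; rewrite /h fx1.
  by case: (f x) (fNy x) => // c _ _; exists c.
exists x, c => // z; case fz : (f z) (fNy z) => [b||]// _; last by rewrite leey.
rewrite lee_fin.
(* Replacing [u t] by [y0] costs at most [t * (A + D)]; [D] is uniform in [t] because [xt] stays in
   [K]. Then [t] tends to 0. *)
pose D := d%:R * `|y1 - y0| * C.
pose A := `|dot (y1 - y0) z|.
apply: (@le_of_le_addM _ _ (A + D)).
move=> t t01; have [xt [bt [fxt xtC sxt]]] := key t t01.
have t0 : 0 <= t by case/andP: t01 => /ltW.
have hD : t * dot (y1 - y0) xt <= t * D.
  rewrite ler_wpM2l// (le_trans (ler_norm _))//.
  by apply: (le_trans (dot_le_norm _ _)); rewrite ler_wpM2l ?mulr_ge0.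
have hA : t * - dot (y1 - y0) z <= t * A.
  by rewrite ler_wpM2l// (le_trans (ler_norm _))// normrN.
have := sxt z; rewrite fz lee_fin.
have := xmin xt xtC; rewrite /h fx fxt -!EFinD lee_fin.
have -> : u t = y0 + t *: (y1 - y0) by apply/rowP => i; rewrite !mxE; ring.
by rewrite !(dotDl (z - xt)) dotZl !(dotDr, dotNr); lra.
Qed.

End convex_efun.

(** * Strict convexity, subgradients and directional derivatives *)

Section subgradients.
Context {R : realType} {d : nat}.
Implicit Types f : 'rV[R]_d -> \bar R.

(** Contrapositive form of strict convexity at midpoints: a midpoint value no lower than the average
    forces the points to coincide. *)
Definition strictly_midconvex f := forall x y (a b : R),
  (f x <= a%:E)%E -> (f y <= b%:E)%E ->
  (((a + b) / 2)%:E <= f (2^-1 *: x + 2^-1 *: y)%R)%E -> x = y.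

Lemma subgradient_inj f x z p : strictly_midconvex f ->
  subgradient f x p -> subgradient f z p -> x = z.
Proof.
move=> sf [a fx sx] [b fz sz]; apply: (sf _ _ a b); rewrite ?fx ?fz//.
apply: le_trans (sx _); rewrite lee_fin.
have -> : 2^-1 *: x + 2^-1 *: z - x = 2^-1 *: (z - x).
  by apply/rowP => i; rewrite !mxE; field.
by rewrite dotZr; have := sz x; rewrite fx lee_fin !(dotDr, dotNr); lra.
Qed.

Lemma sphere_compact (x0 : 'rV[R]_d) : compact [set x | `|x - x0| = 1].
Proof.
apply: bounded_closed_compact.
  exists (`|x0| + 1); split; first exact: num_real.
  move=> N /ltW cN x /= x1; apply: le_trans cN.
  by rewrite -(subrK x0 x) (le_trans (ler_normD _ _))// x1 addrC.
have ct (x : 'rV[R]_d) : `|z - x0| @[z --> x] --> `|x - x0|.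
  have c1 : id @ x --> x by exact: cvg_id.
  exact: (cvg_norm (cvgB c1 (cvg_cst x0))).
exact: (@closed_comp _ _ (fun x : 'rV[R]_d => `|x - x0|) [set t : R | t = 1]
  (fun x _ => ct x) (@closed_eq _ _)).
Qed.

(* If [x0] is the only minimizer of [h := f - dot y0] then [h - h x0] is at least
   some [e > 0] on the unit sphere around [x0], hence grows at least linearly
   with slope [e] outside the ball, and so absorbs perturbations of [y0]. *)
Lemma unique_subgradient_interior f x0 y0 : (forall x, -oo < f x)%E ->
  convex_efun f -> lower_semicontinuous f -> strictly_midconvex f ->
  subgradient f x0 y0 -> (edom (conjugate f))° y0.
Proof.
move=> fNy cf lf sf /[dup] sub0 [a fx0 sx0].
pose h x := (f x + (- dot y0 x)%:E)%E.
have lh : lower_semicontinuous h.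
  apply: lscD_continuous => // x.
  exact: (@cvgN _ _ _ (nbhs x) _ _ _ (continuous_dot _ x)).
pose h0 := a - dot y0 x0.
have [e e0 he] : exists2 e : R, 0 < e &
    forall x, `|x - x0| = 1 -> ((h0 + e)%:E <= h x)%E.
  (* In dimension 0 the sphere is empty and any [e] will do. *)
  have [K0|/set0P K0] := eqVneq [set x : 'rV[R]_d | `|x - x0| = 1] set0.
    exists 1 => // x x1; suff : (set0 : set 'rV[R]_d) x by [].
    by rewrite -K0.
  have [x /= x1 xm] := lsc_compact_argmin _ _ _ lh (sphere_compact x0) K0.
  have : (h0%:E < h x)%E.
    rewrite ltNge; apply/negP => hx.
    case fx : (f x) (fNy x) => [c||]// _; last by rewrite /h fx in hx.
    have : x = x0.
      apply: (@subgradient_inj f x x0 y0) => //; exists c => // z.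
      apply: le_trans (sx0 z); rewrite lee_fin.
      by move: hx; rewrite /h fx /h0 -EFinD lee_fin !(dotDr, dotNr); lra.
    move: x1 => /[swap] ->; rewrite subrr normr0 => /eqP.
    by rewrite eq_sym oner_eq0.
  move=> /lte_between[c]; rewrite lte_fin => hc ch.
  exists (c - h0); first by rewrite subr_gt0.
  by move=> z z1; rewrite addrC subrK (le_trans (ltW ch))// xm.
have growth x c : f x = c%:E -> 1 <= `|x - x0| ->
    e * `|x - x0| <= c - dot y0 x - h0.
  move=> fx; set n := `|x - x0| => n1.
  have n0 : 0 < n by apply: lt_le_trans n1.
  (* Radial projection of [x] to the unit sphere; convexity carries the bound there out to [x]. *)
  pose w := (1 - n^-1) *: x0 + n^-1 *: x.
  have w1 : `|w - x0| = 1.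
    have -> : w - x0 = n^-1 *: (x - x0).
      by apply/rowP => i; rewrite !mxE; ring.
    by rewrite normrZ gtr0_norm ?invr_gt0// mulVf// gt_eqF.
  have t01 : 0 <= n^-1 <= 1 by rewrite invr_ge0 ltW//= invf_le1.
  have fw : (f w <= ((1 - n^-1) * a + n^-1 * c)%:E)%E.
    by apply: cf => //; rewrite ?fx0 ?fx.
  have := he w w1; rewrite /h => hw.
  have := le_trans hw (leeD2r _ fw).
  rewrite -EFinD lee_fin /w dotDr !dotZr -/h0 => hh.
  rewrite mulrC -ler_pdivlMl// mulrC.
  have -> : (c - dot y0 x - h0) / n = n^-1 * c - n^-1 * dot y0 x - n^-1 * h0.
    by ring.
  by move: hh; rewrite /h0; lra.
have K0 : 0 < d%:R + 1 :> R by rewrite ltr_wpDl.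
(* On this ball [dot (y - y0) (x - x0)] is at most [e] times the norm of [x - x0]. Outside the unit
   ball [growth] absorbs it; inside it is at most [e], which explains the bound below. *)
apply: (@interior_ball _ _ _ _ (e / (d%:R + 1))); first exact: divr_gt0.
move=> y yy0; rewrite /edom/=.
apply: (@le_lt_trans _ _ (e + dot (y - y0) x0 - h0)%:E); last exact: ltry.
apply/le_conjugateP => // x c fc.
have [c' fx] : exists c', f x = c'%:E.
  by move: fc (fNy x); case: (f x) => // c' _ _; exists c'.
move: fc; rewrite fx lee_fin => cc'.
have : dot (y - y0) (x - x0) <= e * `|x - x0|.
  rewrite (le_trans (ler_norm _))// (le_trans (dot_le_norm _ _))//.
  rewrite ler_wpM2r//.
  have : (d%:R + 1) * `|y - y0| < e by rewrite mulrC -ltr_pdivlMr.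
  have := normr_ge0 (y - y0); lra.
rewrite dotDr !dotNr !dotDl !dotNl.
have [n1|n1] := leP 1 (`|x - x0|).
  by have := growth x c' fx n1; rewrite /h0; lra.
have : e * `|x - x0| <= e by rewrite ler_piMr// ltW.
by have := sx0 x; rewrite fx lee_fin /h0 !(dotDr, dotNr); lra.
Qed.

Lemma derive_dot_gradient (F : 'rV[R]_d -> R) x v :
  differentiable (F : _ -> R^o) x ->
  'D_v (F : _ -> R^o) x = dot (gradient F x) v.
Proof.
move=> dF; rewrite deriveE//.
rewrite [in LHS](row_sum_delta v) linear_sum /dot; apply: eq_bigr => i _.
by rewrite linearZ /= /gradient mxE deriveE// mulrC.
Qed.

Lemma derive_ge (F : 'rV[R]_d -> R) x v (k e : R) :
  differentiable (F : _ -> R^o) x -> 0 < e ->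
  (forall t, 0 < t < e -> t * k <= F (x + t *: v) - F x) ->
  k <= 'D_v (F : _ -> R^o) x.
Proof.
move=> dF e0 h.
have dv : derivable (F : _ -> R^o) x v by exact: diff_derivable.
have : h^-1 *: ((F \o shift x) (h *: v) - F x) @[h --> 0^'] -->
    'D_v (F : _ -> R^o) x.
  exact: dv.
move=> /cvg_dnbhs_at_right cv.
rewrite -(cvg_lim _ cv)//; apply: limr_ge.
  by apply/cvg_ex; exists ('D_v (F : _ -> R^o) x).
near=> t.
have t0 : 0 < t by [].
rewrite /= [_ *: _]mulrC ler_pdivlMr// mulrC addrC.
have -> : F (shift x (t *: v)) = F (x + t *: v) by rewrite /shift addrC.
rewrite addrC; apply: h; rewrite t0/=; near: t.
exact: nbhs_right_lt.
Unshelve. all: by end_near. Qed.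

End subgradients.

(** * Essentially smooth functions and minimizers of their conjugates *)

Section essentially_smooth.
Context {R : realType} {d : nat}.
Implicit Types f : 'rV[R]_d -> \bar R.

Lemma derive_le (F : 'rV[R]_d -> R) x v (k e : R) :
  differentiable (F : _ -> R^o) x -> 0 < e ->
  (forall t, 0 < t < e -> F (x + t *: v) - F x <= t * k) ->
  'D_v (F : _ -> R^o) x <= k.
Proof.
move=> dF e0 h; rewrite -lerN2.
have dN : differentiable (- (F : _ -> R^o) : _ -> R^o) x.
  exact: differentiableN.
rewrite -deriveN; last exact: diff_derivable.
apply: (derive_ge (fun z => - F z) _ _ _ e dN e0) => t te.
by have := h t te; lra.
Qed.

(** By convexity every difference quotient from [x] towards [z] is at most [f z - f x], hence so is
    the directional derivative. *)
Lemma gradient_subgradient f x : (forall x, -oo < f x)%E -> convex_efun f ->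
  edom f x -> differentiable (fine \o f : _ -> R^o) x ->
  subgradient f x (gradient (fine \o f) x).
Proof.
move=> fNy cf; rewrite /edom/=; case fx : (f x) (fNy x) => [a||]// _ _ dF.
exists a => // z; case fz : (f z) (fNy z) => [c||]// _; last by rewrite leey.
rewrite lee_fin -derive_dot_gradient// -lerBrDl.
apply: (derive_le _ _ _ _ 1 dF) => // t /andP[t0 /ltW t1].
have -> : x + t *: (z - x) = (1 - t) *: x + t *: z.
  by apply/rowP => i; rewrite !mxE; ring.
have := cf x z a c t; rewrite (ltW t0) t1 fx fz !lexx => /(_ isT isT isT).
rewrite /= fx /=; case: (f _) (fNy ((1 - t) *: x + t *: z)) => // b _.
by rewrite lee_fin /=; lra.
Qed.

(** In every direction the slope of [p] is at most the derivative; the direction [p - gradient]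
    forces equality. *)
Lemma subgradient_gradient f x p : (forall x, -oo < f x)%E ->
  (edom f)° x -> differentiable (fine \o f : _ -> R^o) x ->
  subgradient f x p -> p = gradient (fine \o f) x.
Proof.
move=> fNy /near_ball_sub[e e0 xf] dF [a fx sx].
have h v : dot p v <= dot (gradient (fine \o f) x) v.
  rewrite -derive_dot_gradient//.
  have v0 : 0 < `|v| + 1 by rewrite ltr_wpDl.
  apply: (derive_ge _ _ _ _ _ dF (divr_gt0 e0 v0)) => t /andP[t0 te].
  have : edom f (x + t *: v).
    apply: xf; rewrite addrAC subrr add0r normrZ gtr0_norm//.
    apply: le_lt_trans (_ : t * (`|v| + 1) < e); last by rewrite -ltr_pdivlMr.
    by rewrite ler_wpM2l ?lerDl// ltW.
  have := sx (x + t *: v); rewrite /= fx /= /edom/= addrAC subrr add0r dotZr.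
  case: (f _) (fNy (x + t *: v)) => // b _; rewrite lee_fin /=; lra.
apply/eqP; rewrite -subr_eq0; apply/eqP/dot_self_eq0/eqP; rewrite eq_le.
apply/andP; split; last by apply: sumr_ge0 => i _; rewrite -expr2 sqr_ge0.
by have := h (p - gradient (fine \o f) x); rewrite dotDl dotNl; lra.
Qed.

(* Gradients along the segment to a boundary point with a subgradient would stay
   bounded. *)
Lemma essentially_smooth_subgradient_interior f x p :
  (forall x, -oo < f x)%E -> convex_efun f -> essentially_smooth f ->
  subgradient f x p -> (edom f)° x.
Proof.
move=> fNy cf [[x1 fx1] df steep] [a0 fx sx].
have edfx : edom f x by rewrite /edom/= fx ltry.
apply: contrapT => nx.
(* [harmonic n] is [1 / (n + 1)], so all weights lie in ]0, 1] and every [u n] is interior. *)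
pose t n : R := harmonic n.
have t01 n : 0 < t n <= 1 by rewrite harmonic_gt0/= invf_le1// ler1n.
pose u n := (1 - t n) *: x + t n *: x1.
have uint n : (edom f)° (u n).
  apply: convex_interior => // z w; apply: convex_edom => //.
  by case/andP: (t01 n) => /ltW -> ->.
have uE n : u n = x + t n *: (x1 - x) by apply/rowP => i; rewrite !mxE; ring.
have cu : u @ \oo --> x.
  have ct : t @ \oo --> (0 : R) by exact: cvg_harmonic.
  have : x + t n *: (x1 - x) @[n --> \oo] --> x + 0 *: (x1 - x).
    by apply: cvgD; [exact: cvg_cst|exact: cvgZl].
  rewrite scale0r addr0; apply: cvg_trans.
  by rewrite (_ : u = fun n => x + t n *: (x1 - x))//; apply/funext.
have := steep u x uint cu (conj (subset_closure edfx) nx).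
have [r [M [r0 M0 fM frM]]] := interior_edom_bound _ _ fx1.
pose C := (M - a0 - dot p (x1 - x)) / r.
(* The sup norms of the gradients are bounded by [C]; the factor converts this to the Euclidean norm
   of the steepness condition. *)
move=> /cvgryPgt /(_ (Num.sqrt d%:R * C)) [N _ /(_ N)].
rewrite /= leqnn => /(_ isT).
apply/negP; rewrite -leNgt.
apply: (le_trans (enorm_le_norm _)); rewrite ler_wpM2l ?sqrtr_ge0//.
have [b fu su] := gradient_subgradient f (u N) fNy cf
  (interior_subset (uint N)) (df _ (uint N)).
rewrite /C ler_pdivlMr// mulrC.
apply: (@subgradient_bound _ _ f x x1 _ p a0 b (t N)) => //.
  by rewrite fx.
by have := sx (u N); rewrite fu lee_fin.
Qed.

Lemma essentially_smooth_subgradient_unique f x p q :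
  (forall x, -oo < f x)%E -> convex_efun f -> essentially_smooth f ->
  subgradient f x p -> subgradient f x q -> p = q.
Proof.
move=> fNy cf sf sp sq.
have xf := essentially_smooth_subgradient_interior _ _ _ fNy cf sf sp.
have [_ /(_ x xf) df _] := sf.
rewrite (subgradient_gradient _ _ p fNy xf)//.
by rewrite (subgradient_gradient _ _ q fNy xf).
Qed.

Section argmin_conjugate.
Variables (f : 'rV[R]_d -> \bar R) (S : set 'rV[R]_d).
Hypotheses (fNy : forall x, (-oo < f x)%E) (cf : convex_efun f).

(** Young's inequality at the vertices of a cross-polytope around 0 gives a lower bound
    [r * |y| - M] for the conjugate. *)
Lemma argmin_conjugate_exists : (edom f)° 0 -> closed S -> S !=set0 ->
  argmin (conjugate f) S !=set0.
Proof.
move=> /interior_edom_bound[r [M [r0 M0 f0M frM]]] cS S0.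
apply: (lsc_coercive_argmin _ _ _ r M (conjugate_lsc f fNy)) => // y.
have le_sub x : (f x <= M%:E)%E -> ((dot y x - M)%:E <= conjugate f y)%E.
  case fx : (f x) (fNy x) => [c||]// _; rewrite lee_fin => cM.
  by apply: le_trans (young _ _ y _ fx); rewrite lee_fin lerD2l lerN2.
case gy : (conjugate f y) => [c||]; [|by rewrite leey|]; last first.
  by have := le_sub 0 f0M; rewrite gy leeNy_eq.
rewrite lee_fin lerBlDr; apply: norm_le_support => //.
  by have := le_sub 0 f0M; rewrite gy lee_fin dot0r; lra.
move=> i s sr; have := le_sub _ (frM i s sr); rewrite gy lee_fin add0r.
by rewrite dotZr dot_delta; lra.
Qed.

Hypotheses (lf : lower_semicontinuous f) (sf : strictly_midconvex f)
  (ef : essentially_smooth f).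
Hypotheses (cS : forall x y (t : R), 0 <= t <= 1 -> S x -> S y ->
  S ((1 - t) *: x + t *: y)).

Let E := edom (conjugate f).

Lemma argmin_conjugate_subgradient y : E° `&` S !=set0 ->
  argmin (conjugate f) S y -> exists x, subgradient f x y.
Proof.
move=> [y1 [Ey1 Sy1]] [Sy ymin].
have f0 : edom f !=set0.
  by case: ef => -[x /interior_subset fx] _ _; exists x.
apply: (segment_subgradient f y y1) => //.
  apply: le_lt_trans (ymin _ Sy1) _; exact: (interior_subset Ey1).
by move=> t /andP[t0 t1]; apply: ymin; apply: cS => //; rewrite ltW.
Qed.

Lemma argmin_conjugate_interior y : E° `&` S !=set0 ->
  argmin (conjugate f) S y -> E° y.
Proof.
move=> ES /argmin_conjugate_subgradient[]// x.
exact: unique_subgradient_interior.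
Qed.

(* A subgradient [x] at the midpoint [m] of two minimizers is one at both, so
   both are gradients of [f] at [x]. *)
Lemma argmin_conjugate_unique y z : E° `&` S !=set0 ->
  argmin (conjugate f) S y -> argmin (conjugate f) S z -> y = z.
Proof.
move=> ES my mz; have [Sy ymin] := my; have [Sz zmin] := mz.
have f0 : edom f !=set0.
  by case: ef => -[x /interior_subset fx] _ _; exists x.
have Ey := interior_subset (argmin_conjugate_interior _ ES my).
have [a gy] : exists a : R, conjugate f y = a%:E.
  have := conjugate_gtNy f y fNy f0; move: Ey; rewrite /E /edom/=.
  by case: (conjugate f y) => // a; exists a.
have gz : conjugate f z = a%:E.
  by apply/eqP; rewrite -gy eq_le zmin// ymin.
have half : 0 <= (2^-1 : R) <= 1 by lra.
set m := (1 - 2^-1) *: y + 2^-1 *: z.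
have Sm : S m by exact: cS.
have gm : (conjugate f m <= a%:E)%E.
  have := conjugate_convex f fNy y z a a 2^-1 half.
  rewrite gy gz lexx => /(_ isT isT) h; apply: le_trans h _; rewrite lee_fin; lra.
have mm : argmin (conjugate f) S m.
  by split => // w /ymin; rewrite gy; exact: le_trans.
have [x [b fx sx]] := argmin_conjugate_subgradient _ ES mm.
(* The conjugate at [m] equals [dot m x - b]. Since [dot m x] averages [dot y x] and [dot z x],
   Young's inequality must be an equality at both [y] and [z]. *)
have am : a <= dot m x - b.
  rewrite -lee_fin -gy; apply: (le_trans (ymin _ Sm)).
  apply/le_conjugateP => // w c fc; have := le_trans (sx w) fc.
  by rewrite lee_fin !(dotDr, dotNr); lra.
have ay : dot y x - b <= a by have := young _ _ y _ fx; rewrite gy lee_fin.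
have az : dot z x - b <= a by have := young _ _ z _ fx; rewrite gz lee_fin.
have sub w : conjugate f w = a%:E -> a <= dot w x - b -> subgradient f x w.
  move=> gw aw; exists b => // v; case fv : (f v) (fNy v) => [c||]// _.
    have := young _ _ w _ fv; rewrite gw !lee_fin !(dotDr, dotNr); lra.
  by rewrite leey.
have md : dot m x = (dot y x + dot z x) / 2 by rewrite !dotE; lra.
apply: (essentially_smooth_subgradient_unique f x) => //; apply: sub => //; lra.
Qed.

Lemma argmin_conjugate_singleton : (edom f)° 0 -> closed S ->
  E° `&` S !=set0 -> exists y, argmin (conjugate f) S = [set y] /\ (E° `&` S) y.
Proof.
move=> f0 clS ES; have [y my] := argmin_conjugate_exists f0 clS
  (let: ex_intro y (conj _ Sy) := ES in ex_intro _ y Sy).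
exists y; split; last first.
  by split; [exact: argmin_conjugate_interior|case: my].
apply/seteqP; split => [z mz|z ->//]; exact: argmin_conjugate_unique.
Qed.

End argmin_conjugate.
End essentially_smooth.

(** * The log-Laplace transform *)

Section log_laplace.
Context {R : realType} {d : nat}.
Implicit Types x y z : 'rV[R]_d.

Lemma continuous_dotl x : continuous (fun y => dot y x).
Proof.
rewrite (_ : (fun y => _) = dot x); first exact: continuous_dot.
by apply/funext => y; exact: dotC.
Qed.

Lemma closed_measurable_rV (A : set 'rV[R]_d) : closed A -> measurable A.
Proof.
rewrite -openC => oA; rewrite -(setCK A); apply: measurableC.
exact: sub_sigma_algebra.
Qed.

Lemma continuous_measurable_rV (h : 'rV[R]_d -> R) (D : set 'rV[R]_d) :
  continuous h -> measurable D -> measurable_fun D h.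
Proof.
move=> /continuousP ch mD _.
apply: (measurability _ (RGenOpens.measurableE R)) => //.
move=> _ [_ [a [b ->] <-]]; apply: measurableI => //.
by apply: sub_sigma_algebra; apply: ch; exact: interval_open.
Qed.

Lemma measurable_expR_dot (D : set 'rV[R]_d) x (a : R) : measurable D ->
  measurable_fun D (fun y => (expR (dot y x - a))%:E).
Proof.
move=> mD; apply/measurable_EFinP.
apply: (@measurableT_comp _ _ _ _ _ _ expR D (fun y => dot y x - a)).
  exact: measurable_expR.
apply: continuous_measurable_rV => // y.
exact: (@cvgB _ _ _ (nbhs y) _ _ _ _ _ (continuous_dotl x y) (cvg_cst a)).
Qed.

Lemma measurable_expR_dot0 (D : set 'rV[R]_d) x : measurable D ->
  measurable_fun D (fun y => (expR (dot y x))%:E).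
Proof.
by move=> mD; have := measurable_expR_dot D x 0 mD; under eq_fun do rewrite subr0.
Qed.

Lemma integral_eq0_null d0 (T : measurableType d0)
    (mu : {measure set T -> \bar R}) (D : set T) (f : T -> R) :
  measurable D -> measurable_fun D (EFin \o f) ->
  (forall w, D w -> 0 <= f w) ->
  (\int[mu]_(w in D) (f w)%:E <= 0)%E -> mu (D `&` [set w | f w != 0]) = 0%E.
Proof.
move=> mD mf f0 If.
have I0 : (\int[mu]_(w in D) `|(EFin \o f) w|)%E = 0%E.
  apply/eqP; rewrite eq_le integral_ge0// andbT.
  apply: le_trans If; rewrite le_eqVlt; apply/orP; left; apply/eqP.
  by apply: eq_integral => x /set_mem Dx; rewrite /= ger0_norm ?f0.
have /(ae_eq_integral_abs mu mD mf)[N [mN N0 sN]] := I0.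
apply/eqP; rewrite eq_le measure_ge0 andbT -N0; apply: le_measure; rewrite ?inE//.
  rewrite (_ : D `&` _ = D `&` (EFin \o f) @^-1` (~` [set 0%E])).
    by apply: mf => //; apply: measurableC; exact: emeasurable_set1.
  apply/seteqP; split => z [Dz /= fz]; split => //=.
    by move=> -[fz0]; rewrite fz0 eqxx in fz.
  by apply/eqP => fz0; apply: fz; rewrite fz0.
by move=> z [Dz /= fz]; apply: sN => /= /(_ Dz) [fz0]; rewrite fz0 eqxx in fz.
Qed.

Section probability.
Variables (Omega : set 'rV[R]_d) (P : probability 'rV[R]_d R).
Hypotheses (mO : measurable Omega) (PO : P Omega = 1%E).

Let f := psi Omega P.

Lemma psi_gtNy x : (-oo < f x)%E.
Proof. by rewrite /f /psi; case: ifP => _; rewrite ?ltNyr. Qed.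

Lemma laplace_shift x (a : R) :
  (\int[P]_(y in Omega) (expR (dot y x - a))%:E =
   (expR (- a))%:E * laplace Omega P x)%E.
Proof.
rewrite /laplace -ge0_integralZl//.
  by apply: eq_integral => y _; rewrite -EFinM -expRD addrC.
exact: measurable_expR_dot0.
Qed.

Lemma laplace_ge0 x : (0 <= laplace Omega P x)%E.
Proof. by apply: integral_ge0 => y _; rewrite lee_fin expR_ge0. Qed.

Lemma laplace_gt0 x : (0 < laplace Omega P x)%E.
Proof.
rewrite lt_neqAle laplace_ge0 andbT; apply/eqP => L0.
have /eqP : P (Omega `&` [set y | expR (dot y x) != 0]) = 0%E.
  apply: integral_eq0_null => //; first last.
  - by rewrite -/(laplace Omega P x) -L0.
  - exact: measurable_expR_dot0.
rewrite (_ : _ `&` _ = Omega) ?PO ?onee_eq0//.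
by apply/seteqP; split => [y []//|y Oy]; split => //=; rewrite gt_eqF ?expR_gt0.
Qed.

Lemma psi_leP x (a : R) :
  (f x <= a%:E)%E <-> (laplace Omega P x <= (expR a)%:E)%E.
Proof.
have := laplace_gt0 x; rewrite /f /psi; case: asboolP; rewrite /Theta/=.
  case: (laplace Omega P x) => [c||]// _; rewrite lte_fin => c0.
  by rewrite !lee_fin -ler_expR lnK.
by case: (laplace Omega P x) => [c||]//; rewrite ?ltry.
Qed.

Lemma psi_geP x (a : R) :
  (a%:E <= f x)%E <-> ((expR a)%:E <= laplace Omega P x)%E.
Proof.
have := laplace_gt0 x; rewrite /f /psi; case: asboolP; rewrite /Theta/=.
  case: (laplace Omega P x) => [c||]// _; rewrite lte_fin => c0.
  by rewrite !lee_fin -ler_expR lnK.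
by case: (laplace Omega P x) => [c||]//; rewrite ?ltry// !leey.
Qed.

(** Normalized form of the bound on [f]: it reduces convexity statements to pointwise inequalities
    between integrands. *)
Lemma integral_le1 x (a : R) : (f x <= a%:E)%E ->
  (\int[P]_(y in Omega) (expR (dot y x - a))%:E <= 1)%E.
Proof.
move=> /psi_leP La; rewrite laplace_shift.
apply: le_trans (lee_wpmul2l _ La) _; first by rewrite lee_fin expR_ge0.
by rewrite -EFinM -expRD addNr expR0.
Qed.

Lemma expR_convex_comb (u v t : R) : 0 <= t <= 1 ->
  expR ((1 - t) * u + t * v) <= (1 - t) * expR u + t * expR v.
Proof.
move=> /andP[t0 t1]; rewrite addrC [leRHS]addrC.
exact: (convex_expR (Itv01 t0 t1) v u).
Qed.

(** Convexity of the exponential, applied pointwise to the normalized integrands, takes the place of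
    Hölder's inequality. *)
Lemma psi_convex : convex_efun f.
Proof.
move=> x y a b t t01 fx fy; apply/psi_leP.
set z := _ + _; set c := (1 - t) * a + t * b.
suff : (\int[P]_(w in Omega) (expR (dot w z - c))%:E <= 1)%E.
  rewrite laplace_shift => h.
  have := lee_wpmul2l (_ : 0 <= (expR c)%:E)%E h.
  rewrite muleA -EFinM -expRD addrN expR0 mul1e mule1; apply.
  by rewrite lee_fin expR_ge0.
have /andP[t0 t1] := t01.
have m x' a' := measurable_expR_dot _ x' a' mO.
have e0 x' (a' : R) w : Omega w -> (0 <= (expR (dot w x' - a'))%:E)%E.
  by rewrite lee_fin expR_ge0.
apply: (@le_trans _ _ (\int[P]_(w in Omega)
    ((1 - t)%:E * (expR (dot w x - a))%:E + t%:E * (expR (dot w y - b))%:E))%E).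
  apply: ge0_le_integral => //.
  - by apply: emeasurable_funD; apply: measurable_funeM.
  - move=> w _; rewrite -!EFinM -EFinD lee_fin.
    apply: le_trans (expR_convex_comb _ _ _ t01).
    by rewrite ler_expR /z /c dotDr !dotZr; lra.
have s0 : (0 <= (1 - t)%:E)%E by rewrite lee_fin subr_ge0.
rewrite ge0_integralD//; last 4 first.
- by move=> w Ow; apply: mule_ge0 => //; exact: e0.
- exact: measurable_funeM.
- by move=> w Ow; apply: mule_ge0 => //; exact: e0.
- exact: measurable_funeM.
rewrite !ge0_integralZl//; [|by move=> w; exact: e0..].
have := leeD (lee_wpmul2l s0 (integral_le1 x a fx))
  (lee_wpmul2l (_ : 0 <= t%:E)%E (integral_le1 y b fy)).
by rewrite !mule1 -EFinD subrK; apply.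
Qed.

(** Otherwise some sequence [z n] tends to [x] with [f (z n) <= a], and Fatou's lemma gives
    [f x <= a]. *)
Lemma psi_lsc : lower_semicontinuous f.
Proof.
move=> x a ax; exists [set z | (a%:E < f z)%E] => //.
apply: contrapT => nx.
have /choice[z zP] n : exists z, `|z - x| < harmonic n :> R /\ (f z <= a%:E)%E.
  apply: contrapT => h; apply: nx; apply: (@interior_ball _ _ _ x (harmonic n)).
    exact: harmonic_gt0.
  by move=> z zx /=; rewrite ltNge; apply/negP => fz; apply: h; exists z.
have cz : z @ \oo --> x.
  apply/cvgrPdist_lt => e e0.
  have ch : (harmonic : R^nat) @ \oo --> (0 : R) by exact: cvg_harmonic.
  apply: filterS (cvgr_lt _ ch _ e0) => n he.
  by rewrite distrC (lt_trans (zP n).1).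
suff : (f x <= a%:E)%E by rewrite leNgt ax.
apply/psi_leP.
have := fatou P mO (fun n => measurable_expR_dot0 _ (z n) mO)
  (fun n w _ => expR_ge0 _).
rewrite (_ : (\int[P]_(w in Omega) _)%E = laplace Omega P x); last first.
  apply: eq_integral => w _.
  have cw : dot w (z n) @[n --> \oo] --> dot w x.
    exact: (cvg_comp _ _ cz (continuous_dot w x)).
  have ce : expR (dot w (z n)) @[n --> \oo] --> expR (dot w x).
    exact: (@continuous_cvg _ _ _ _ _ _ expR _ (@continuous_expR R (dot w x)) cw).
  have cE : (expR (dot w (z n)))%:E @[n --> \oo] --> (expR (dot w x))%:E.
    by apply: cvg_EFin; [exact: nearW|exact: ce].
  by rewrite (cvg_limn_einf_sup cE).1.
move=> /le_trans; apply.
rewrite limn_einf_lim; apply: lime_le; first exact: is_cvg_einfs.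
apply: nearW => n; apply: le_trans (_ : laplace Omega P (z n) <= _)%E.
  by apply: ereal_inf_lbound; exists n => //=.
by apply/psi_leP; case: (zP n).
Qed.

End probability.
End log_laplace.

(** * Strict convexity of the log-Laplace transform *)

Section strict_convexity.
Context {R : realType} {d : nat}.
Variables (Omega : set 'rV[R]_d) (P : probability 'rV[R]_d R).
Hypotheses (mO : measurable Omega) (PO : P Omega = 1%E).
Implicit Types x y v : 'rV[R]_d.

(* If a hyperplane carries P, it contains the whole convex support. *)
Lemma msupport_cc_hyperplane v (c : R) :
  P (Omega `&` [set w | dot w v != c]) = 0%E ->
  (msupport_cc Omega P)° !=set0 -> v = 0.
Proof.
move=> Pv [w0 /near_ball_sub[e e0 wball]].
pose H := [set w : 'rV[R]_d | dot w v = c].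
have cH : closed H.
  exact: (@closed_comp _ _ (fun w : 'rV[R]_d => dot w v) [set t : R | t = c]
    (fun w _ => continuous_dotl v w) (@closed_eq _ _)).
have sH : msupport_cc Omega P `<=` H.
  rewrite /msupport_cc closureE; apply: smallest_sub => //.
  apply: smallest_sub.
    move=> x y l; rewrite !inE /H /= => xc yc.
    change (dot (l%:num *: x + (1 - l%:num) *: y) v = c).
    by rewrite dotDl !dotZl xc yc; ring.
  (* [Omega] cut by the hyperplane is one of the candidate sets whose intersection is the
     support. *)
  suff HP : [set A | [/\ measurable A, exists2 F, closed F & A = Omega `&` F &
      P (Omega `\` A) = 0%E]] (Omega `&` H) by move=> w /(_ _ HP)[].
  split; first exact: measurableI mO (closed_measurable_rV _ cH).
    by exists H.
  rewrite -[RHS]Pv; congr (P _); apply/seteqP; split => w [Ow /= h]; split => //=.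
    by apply/eqP => wc; apply: h; split.
  by move=> [_ wc]; move: h; rewrite wc eqxx.
have h0 : dot w0 v = c by apply/sH/wball; rewrite subrr normr0.
have v0 : 0 < `|v| + 1 by rewrite ltr_wpDl.
(* A step along [v] short enough to stay in the ball, hence in the hyperplane; so [s * dot v v]
   vanishes. *)
pose s := e / 2 / (`|v| + 1).
have s0 : 0 < s by rewrite !divr_gt0.
have : dot (w0 + s *: v) v = c.
  apply/sH/wball; rewrite addrAC subrr add0r normrZ gtr0_norm//.
  apply: (@le_lt_trans _ _ (s * (`|v| + 1))).
    by rewrite ler_wpM2l ?lerDl// ltW.
  by rewrite /s divfK ?gt_eqF//; lra.
rewrite dotDl dotZl h0 => sv; apply: dot_self_eq0.
by apply/eqP; rewrite -(mulrI_eq0 _ (lregP (lt0r_neq0 s0))); apply/eqP; lra.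
Qed.

(* With [u := exp ((dot w x - a) / 2)] and [v] likewise, [\int u^2] and
   [\int v^2] are at most 1 and [\int u v] is at least 1, so
   [\int (u - v)^2 <= 0] and [u = v] almost everywhere. *)
Lemma psi_strictly_midconvex : (msupport_cc Omega P)° !=set0 ->
  strictly_midconvex (psi Omega P).
Proof.
move=> supp x y a b fx fy.
move=> /(psi_geP _ _ mO PO); set m := 2^-1 *: x + 2^-1 *: y => Lm.
pose u w := expR ((dot w x - a) / 2); pose v w := expR ((dot w y - b) / 2).
have uu w : expR (dot w x - a) = u w * u w by rewrite -expRD; congr expR; lra.
have vv w : expR (dot w y - b) = v w * v w by rewrite -expRD; congr expR; lra.
have uv w : expR (dot w m - (a + b) / 2) = u w * v w.
  by rewrite -expRD; congr expR; rewrite /m dotDr !dotZr; lra.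
pose D w := (u w - v w) * (u w - v w).
have m_ z c := measurable_expR_dot Omega z c mO.
have mD : measurable_fun Omega (EFin \o D).
  rewrite (_ : EFin \o D = fun w =>
      ((expR (dot w x - a))%:E + (expR (dot w y - b))%:E - 2%:E * (expR (dot w m - (a + b) / 2))%:E)%E).
    apply: emeasurable_funB; first exact: emeasurable_funD.
    exact: measurable_funeM.
  apply/funext => w; rewrite /= uu vv uv -!(EFinD, EFinM, EFinN); congr EFin.
  by rewrite /D; ring.
have D0 w : 0 <= D w by rewrite /D -expr2 sqr_ge0.
have Im : (1 <= \int[P]_(w in Omega) (expR (dot w m - (a + b) / 2))%:E)%E.
  rewrite (laplace_shift _ _ mO).
  apply: le_trans (lee_wpmul2l _ Lm); last by rewrite lee_fin expR_ge0.
  by rewrite -EFinM -expRD addNr expR0.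
have ID : (\int[P]_(w in Omega) (D w)%:E <= 0)%E.
  (* Integrated form of [(u - v)^2 + 2uv = u^2 + v^2], a sum of nonnegative terms on each side, so
     that no integrals are subtracted. *)
  have eqI : (\int[P]_(w in Omega) (D w)%:E +
      2%:E * \int[P]_(w in Omega) (expR (dot w m - (a + b) / 2))%:E =
    \int[P]_(w in Omega) (expR (dot w x - a))%:E +
    \int[P]_(w in Omega) (expR (dot w y - b))%:E)%E.
    rewrite -ge0_integralZl// -!ge0_integralD//.
    - apply: eq_integral => w _; rewrite uu vv uv -!EFinM -!EFinD; congr EFin.
      by rewrite /D; ring.
    - by move=> w _; rewrite lee_fin.
    - exact: measurable_funeM.
  have h : (\int[P]_(w in Omega) (D w)%:E + 2%:E <= 2%:E)%E.
    have -> : 2%:E = (1 + 1)%E :> \bar R by rewrite -EFinD.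
    apply: le_trans (leeD (integral_le1 _ _ mO PO x a fx)
      (integral_le1 _ _ mO PO y b fy)).
    rewrite -eqI; apply: leeD2l; rewrite -EFinD -[leLHS]mule1.
    by apply: lee_wpmul2l Im; rewrite lee_fin.
  by move: h; rewrite -leeBrDr// subee.
have := integral_eq0_null _ _ P Omega D mO mD (fun w _ => D0 w) ID.
(* As [expR] is injective, [u] and [v] agree exactly on a hyperplane with normal [x - y]. *)
rewrite (_ : _ `&` _ = Omega `&` [set w | dot w (x - y) != a - b]).
  by move=> /msupport_cc_hyperplane /(_ supp) /eqP; rewrite subr_eq0 => /eqP.
congr (_ `&` _); apply/funext => w; rewrite /D /=; congr (is_true (~~ _)).
rewrite mulf_eq0 orbb subr_eq0 /u /v (inj_eq (@expR_inj R)) dotDr dotNr.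
by apply/eqP/eqP; lra.
Qed.

End strict_convexity.

(** * Dominating measures and the theorem on the estimator *)

Lemma dominating_measurable {R : realType} {d : nat} (Omega : set 'rV[R]_d)
    (nu : {measure set 'rV[R]_d -> \bar R}) :
  dominating Omega nu -> measurable Omega.
Proof.
move=> [[-> _]|[cO _]]; first exact: measurableT.
apply: countable_measurable => // x; apply: closed_measurable_rV.
exact: accessible_closed_set1 (hausdorff_accessible (@norm_hausdorff _ _)) _.
Qed.

(** In the countable case [nu] vanishes off [Omega], and domination passes this on to [P]. *)
Lemma dominated_probability1 {R : realType} {d : nat} (Omega : set 'rV[R]_d)
    (nu : {measure set 'rV[R]_d -> \bar R}) (P : probability 'rV[R]_d R) :
  dominating Omega nu -> P `<< nu -> P Omega = 1%E.
Proof.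
move=> dom Pnu; have mO := dominating_measurable _ _ dom.
case: dom => [[-> _]|[_ nuE]]; first exact: probability_setT.
have /null_content_dominatesP/(_ _ (measurableC mO)) PnO := Pnu.
have nu0 : nu (~` Omega) = 0%E.
  by rewrite nuE ?setICl ?measure0//; exact: measurableC.
rewrite -(setCK Omega) probability_setC ?(PnO nu0) ?sube0//; exact: measurableC.
Qed.

Theorem theorem4p1 (R : realType) (d : nat) (Omega : set 'rV[R]_d)
    (nu : {measure set 'rV[R]_d -> \bar R}) (hnu : dominating Omega nu)
    (Lambda : set 'rV[R]_d) (P : 'rV[R]_d -> probability 'rV[R]_d R)
    (hP : reference_family Omega nu Lambda P)
    (h1 : forall l, Lambda l -> assumption1 Omega (P l))
    (h2 : forall l, Lambda l -> assumption2 Omega (P l))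
    (yhat lhat : 'rV[R]_d) (hlhat : Lambda lhat)
    (hyhat : yhat = mean Omega (P lhat))
    (S : set 'rV[R]_d) (hS : closed S)
    (hdom : S `&` edom (cramer Omega (P lhat)) !=set0) :
  mem_estimators Omega (P lhat) S !=set0 /\
  (convex_set (S : set (convex_lmodType 'rV[R]_d)) ->
   (edom (cramer Omega (P lhat)))° `&` S !=set0 ->
   exists y, mem_estimators Omega (P lhat) S = [set y] /\
             ((edom (cramer Omega (P lhat)))° `&` S) y).
Proof.
set Q := P lhat.
have mO := dominating_measurable _ _ hnu.
have QO : Q Omega = 1%E := dominated_probability1 _ _ Q hnu (hP.1 lhat hlhat).
have [[_ supp] steep theta0] := h1 lhat hlhat.
have fNy := psi_gtNy Omega Q.
have domE : edom (psi Omega Q) = Theta Omega Q.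
  apply/seteqP; split => x; rewrite /edom /psi/=; case: asboolP => // _ _.
  exact: ltry.
have f0 : (edom (psi Omega Q))° 0 by rewrite domE.
split.
  apply: argmin_conjugate_exists => //.
  by have [y [Sy _]] := hdom; exists y.
move=> cS ES; apply: argmin_conjugate_singleton => //.
- exact: psi_convex.
- exact: psi_lsc.
- exact: psi_strictly_midconvex.
- move=> x y t /andP[t0 t1] Sx Sy; pose l := Itv01 t0 t1.
  (* [convex_set] puts the weight [l] on its first point, so the points are swapped. *)
  have := cS y x l (mem_set Sy) (mem_set Sx); rewrite inE.
  congr S; change (t *: y + (1 - t) *: x = (1 - t) *: x + t *: y).
  by rewrite addrC.
Qed.
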